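(* Let $m\geq 1$ and $r\geq 1$ be integers. In each sum below $\theta=(\theta_1,\theta_2,\ldots,\theta_p)$ and $p$ is the number of parts of $\theta$. (1) For every integer $q\geq 1$, $$S_{r^m,\bar{q}}=-\sum_{\theta\in\mathcal{C}_m}\binom{m}{\theta_1,\theta_2,\ldots,\theta_p}\big\{\zeta(\bar{q},r\theta_1,r\theta_2,\ldots,r\theta_p)+\zeta(\overline{q+r\theta_1},r\theta_2,\ldots,r\theta_p)\big\}.$$ (2) For every integer $q\geq 2$, $$S_{\bar{r}^m,q}=(-1)^m\sum_{\theta\in\mathcal{C}_m}\binom{m}{\theta_1,\ldots,\theta_p}\Big\{\zeta\big(q,r\theta_1,\ldots,r\theta_p;1,(-1)^{\theta_1},\ldots,(-1)^{\theta_p}\big)+\zeta\big(q+r\theta_1,r\theta_2,\ldots,r\theta_p;(-1)^{\theta_1},(-1)^{\theta_2},\ldots,(-1)^{\theta_p}\big)\Big\}.$$ (3) For every integer $q\geq 1$, $$S_{\bar{r}^m,\bar{q}}=(-1)^{m+1}\sum_{\theta\in\mathcal{C}_m}\binom{m}{\theta_1,\ldots,\theta_p}\Big\{\zeta\big(q,r\theta_1,\ldots,r\theta_p;-1,(-1)^{\theta_1},\ldots,(-1)^{\theta_p}\big)+\zeta\big(q+r\theta_1,r\theta_2,\ldots,r\theta_p;(-1)^{\theta_1+1},(-1)^{\theta_2},\ldots,(-1)^{\theta_p}\big)\Big\}.$$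
   Context: Harmonic numbers and alternating harmonic numbers: $H_n^{(r)}=\sum_{k=1}^n\frac{1}{k^r}$ and $\bar{H}_n^{(r)}=\sum_{k=1}^n\frac{(-1)^{k-1}}{k^r}$ for positive integers $n,r$. Alternating Euler sums: $$S_{r^m,\bar q}=\sum_{n=1}^\infty(-1)^{n-1}\frac{(H_n^{(r)})^m}{n^q},\quad S_{\bar r^m,q}=\sum_{n=1}^\infty\frac{(\bar H_n^{(r)})^m}{n^q},\quad S_{\bar r^m,\bar q}=\sum_{n=1}^\infty(-1)^{n-1}\frac{(\bar H_n^{(r)})^m}{n^q},$$ infinite sums being limits of partial sums. Alternating multiple zeta values: for positive integers $s_j$ and signs $\sigma_j=\pm1$ with $(s_1,\sigma_1)\neq(1,1)$, $$\zeta(s_1,\ldots,s_k;\sigma_1,\ldots,\sigma_k)=\lim_{n\to\infty}\sum_{n\geq n_1>n_2>\cdots>n_k\geq 1}\frac{\sigma_1^{n_1}\cdots\sigma_k^{n_k}}{n_1^{s_1}\cdots n_k^{s_k}}.$$ In the one-string notation (no semicolon), $s_j$ is written in the $j$th position when $\sigma_j=+1$ and $\bar{s}_j$ (or $\overline{s_j}$) when $\sigma_j=-1$; e.g. $\zeta(\bar{s}_1,s_2)=\zeta(s_1,s_2;-1,1)$. A composition of $m$ is an ordered tuple of positive integers summing to $m$, and $\mathcal{C}_m$ is the set of all compositions of $m$. Multinomial coefficients: $\binom{m}{\theta_1,\ldots,\theta_p}=\frac{m!}{\theta_1!\cdots\theta_p!}$. *)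

(* Defs.v *)
From HB Require Import structures.
From mathcomp Require Import all_boot all_order all_algebra.
From mathcomp Require Import all_classical all_reals all_analysis.
Set Implicit Arguments.
Unset Strict Implicit.
Unset Printing Implicit Defensive.
Import Order.TTheory GRing.Theory Num.Theory.
Import numFieldNormedType.Exports.
Local Open Scope classical_set_scope.
Local Open Scope ring_scope.

Definition harmonic_num (R : realType) (r n : nat) : R :=
  \sum_(1 <= k < n.+1) 1 / k%:R ^+ r.

Definition alt_harmonic_num (R : realType) (r n : nat) : R :=
  \sum_(1 <= k < n.+1) (-1) ^+ k.-1 / k%:R ^+ r.

(* Partial sums (n <= N) of S_{r^m, \bar q}, S_{\bar r^m, q} and
   S_{\bar r^m, \bar q}, in this order. *)
Definition S_pow_bar_partial (R : realType) (r m q N : nat) : R :=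
  \sum_(1 <= n < N.+1) (-1) ^+ n.-1 * (harmonic_num R r n ^+ m / n%:R ^+ q).

Definition S_barpow_partial (R : realType) (r m q N : nat) : R :=
  \sum_(1 <= n < N.+1) alt_harmonic_num R r n ^+ m / n%:R ^+ q.

Definition S_barpow_bar_partial (R : realType) (r m q N : nat) : R :=
  \sum_(1 <= n < N.+1)
    (-1) ^+ n.-1 * (alt_harmonic_num R r n ^+ m / n%:R ^+ q).

Definition S_pow_bar (R : realType) (r m q : nat) : R :=
  limn (S_pow_bar_partial R r m q).

Definition S_barpow (R : realType) (r m q : nat) : R :=
  limn (S_barpow_partial R r m q).

Definition S_barpow_bar (R : realType) (r m q : nat) : R :=
  limn (S_barpow_bar_partial R r m q).

(* With k = size s, the sum ranges over the k-tuples t = (n_1, ..., n_k) with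
   n >= n_1 > ... > n_k >= 1.  The strings s (exponents) and sigma (signs, with
   values 1 or -1) are meant to have the same length. *)
Definition amzv_partial (R : realType) (s : seq nat) (sigma : seq R) (n : nat)
    : R :=
  \sum_(t : (size s).-tuple 'I_n.+1 |
        sorted (fun a b : nat => b < a)%N [seq val i | i <- t] &&
        all (fun i : 'I_n.+1 => 0 < i)%N t)
    \prod_(j < size s)
      (nth 1 sigma j ^+ tnth t j / (tnth t j)%:R ^+ nth 0%N s j).

Definition amzv (R : realType) (s : seq nat) (sigma : seq R) : R :=
  limn (amzv_partial s sigma).

Definition compositions (m : nat) : set (seq nat) :=
  [set theta | all (leq 1) theta /\ sumn theta = m].

(* Sums \sum_(theta \in compositions m) are therefore genuine finite sums. *)
Lemma finite_compositions (m : nat) : finite_set (compositions m).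
Proof.
apply: (@sub_finite_set _ _
  ((fun x : {p : 'I_m.+1 & p.-tuple 'I_m.+1} =>
      [seq val i | i <- tagged x]) @` setT)); last first.
  exact/finite_image/finite_finset.
move=> theta [pos sum_m].
have size_le (l : seq nat) : all (leq 1) l -> (size l <= sumn l)%N.
  by elim: l => //= a l IH /andP[a1 /IH]; exact: leq_add a1.
have elt_le (l : seq nat) a : a \in l -> (a <= sumn l)%N.
  elim: l => //= b l IH; rewrite inE => /orP[/eqP->|/IH al].
    exact: leq_addr.
  exact: leq_trans al (leq_addl _ _).
have szP : (size theta < m.+1)%N by rewrite ltnS -sum_m size_le.
pose t := map_tuple (fun a => inord a : 'I_m.+1) (in_tuple theta).
exists (@Tagged _ (Ordinal szP) (fun p : 'I_m.+1 => p.-tuple 'I_m.+1) t) => //=.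
rewrite -map_comp -[RHS]map_id; apply/eq_in_map => a a_in /=.
by rewrite inordK // ltnS -sum_m elt_le.
Qed.

Definition multinom_coef (R : realType) (m : nat) (theta : seq nat) : R :=
  m`!%:R / \prod_(t <- theta) t`!%:R.

(* (q, r theta_1, ..., r theta_p) *)
Definition exps_cons (q r : nat) (theta : seq nat) : seq nat :=
  q :: [seq (r * t)%N | t <- theta].

(* (q + r theta_1, r theta_2, ..., r theta_p), for nonempty theta *)
Definition exps_merge (q r : nat) (theta : seq nat) : seq nat :=
  (q + r * head 0 theta)%N :: [seq (r * t)%N | t <- behead theta].

Definition ones (R : realType) (theta : seq nat) : seq R :=
  [seq 1 | _ <- theta].

(* ((-1)^{theta_1}, ..., (-1)^{theta_p}) *)
Definition parities (R : realType) (theta : seq nat) : seq R :=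
  [seq (-1) ^+ t | t <- theta].

(* Main.v *)
(* Expanding the m-th power of H_n as a sum over m-tuples of indices and grouping
   equal indices gives, for each n, a combination over the compositions theta of m
   of nested sums over n >= n_1 > ... > n_p.  Splitting n > n_1 from n = n_1, the
   partial sums of both sides of the theorem agree exactly, so only convergence of
   the multiple zeta values is at stake.
   Let A_p(n) be the sum of 1/(n_1 ... n_p) over n >= n_1 > ... > n_p >= 1; it
   dominates every inner nested sum.  Summation by parts gives
   \sum_n A_p(n-1)/n^2 <= 2 for all p, by induction on p, which settles an outer
   exponent at least 2.  For the outer factor (-1)^n/n, the coefficients
   b_n = I(n-1)/n, with I the inner sum, tend to 0 (Cesaro's lemma, by induction
   on p) and have bounded variation by the same estimate, so Dirichlet's test
   applies. *)
Require Import Defs.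
From HB Require Import structures.
From mathcomp Require Import all_boot all_order all_algebra.
From mathcomp Require Import all_classical all_reals all_analysis.
From mathcomp Require Import ring lra zify.
Set Implicit Arguments.
Unset Strict Implicit.
Unset Printing Implicit Defensive.
Import Order.TTheory GRing.Theory Num.Theory.
Import numFieldNormedType.Exports.
Local Open Scope classical_set_scope.
Local Open Scope ring_scope.

(** * Partial sums of multiple zeta values as iterated sums *)

(* The largest index is n_1 = k.+1, so the bounds 1 <= n_2 < n_1 become n_2 <= k. *)
Fixpoint nested_sum (R : realType) (w : seq (nat -> R)) (n : nat) : R :=
  if w is f :: w' then \sum_(0 <= k < n) f k.+1 * nested_sum w' k else 1.

Lemma nested_sumS (R : realType) (f : nat -> R) w n :
  nested_sum (f :: w) n.+1 =
  nested_sum (f :: w) n + f n.+1 * nested_sum w n.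
Proof. by rewrite /= big_nat_recr. Qed.

Lemma cons_tuple_bij (T : Type) n :
  bijective (fun p : T * n.-tuple T => [tuple of p.1 :: p.2]).
Proof.
exists (fun t => (thead t, [tuple of behead t])) => [[x t]|t] /=.
  by rewrite theadE; congr pair; apply: val_inj.
by rewrite [RHS]tuple_eta; apply: val_inj.
Qed.

(** Induction on [w], peeling off the largest index. The bound enters as a virtual entry [k.+1] at
    the head of the path, so the tail satisfies the same condition under its own bound, while the
    index type ['I_N] stays fixed. *)
Lemma tuple_sum_nested (R : realType) (f0 : nat -> R) w N k : (k < N)%N ->
  \sum_(t : (size w).-tuple 'I_N |
        path (fun a b : nat => b < a)%N k.+1 [seq val i | i <- t] &&
        all (fun i : 'I_N => 0 < i)%N t)
    \prod_(j < size w) nth f0 w j (tnth t j) = nested_sum w k.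
Proof.
elim: w k => [|f w IHw] k ltkN /=.
  rewrite (big_pred1 [tuple]) ?big_ord0// => t.
  by rewrite tuple0/=; apply/esym/eqP.
rewrite (reindex _ (onW_bij _ (cons_tuple_bij _ _)))/=.
rewrite (eq_bigl (fun p : 'I_N * (size w).-tuple 'I_N =>
    (p.1 < k.+1)%N && (0 < p.1)%N &&
    (path (fun a b : nat => b < a)%N p.1 [seq val i | i <- p.2] &&
     all (fun i : 'I_N => 0 < i)%N p.2))); last first.
  by move=> [i t] /=; rewrite -!andbA; congr andb; rewrite andbCA.
rewrite -(pair_big_dep (fun i : 'I_N => (i < k.+1)%N && (0 < i)%N)
  (fun (i : 'I_N) (t : (size w).-tuple 'I_N) =>
    path (fun a b : nat => b < a)%N i [seq val i | i <- t] &&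
     all (fun i : 'I_N => 0 < i)%N t)
  (fun i t => \prod_(j < (size w).+1)
      nth f0 (f :: w) j (tnth [tuple of i :: t] j)))/=.
transitivity (\sum_(i < N | (i < k.+1)%N && (0 < i)%N)
    f i * nested_sum w i.-1).
  apply: eq_bigr => i /andP[ik i0]; rewrite -IHw; last first.
    by rewrite (leq_ltn_trans (leq_pred _)).
  rewrite prednK// big_distrr; apply: eq_bigr => t _ /=.
  rewrite big_ord_recl/= tnth0; congr *%R; apply: eq_bigr => j _.
  by rewrite tnthS.
rewrite -(big_mkord (fun i => (i < k.+1)%N && (0 < i)%N)
  (fun i => f i * nested_sum w i.-1)).
case: N ltkN {IHw} => // N; rewrite ltnS => kN.
rewrite big_mkcond big_nat_recl//= add0r (big_nat_widen _ _ _ _ _ kN)/=.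
by rewrite [RHS]big_mkcond/=; apply: eq_bigr => i _; rewrite ltnS andbT.
Qed.

Lemma amzv_partialE (R : realType) (s : seq nat) (sigma : seq R) :
  amzv_partial s sigma =
  nested_sum (mkseq (fun j k => nth 1 sigma j ^+ k / k%:R ^+ nth 0%N s j)
                    (size s)).
Proof.
apply/funext => n.
rewrite -(@tuple_sum_nested _ (fun=> 0) _ n.+1 n)// /amzv_partial.
rewrite size_mkseq.
apply: eq_big => [t|t _].
  (* All entries lie below [n.+1], so prefixing this value leaves sortedness unchanged. *)
  congr andb; case: t => [[|i t] //= _].
  by rewrite ltn_ord.
by apply: eq_bigr => j _; rewrite nth_mkseq.
Qed.

(** The inner weights become powers of the single weight x^k / k^r, the shape produced by the
    multinomial expansion. *)
Lemma amzv_partial_map (R : realType) (r : nat) (x : R) (theta : seq nat) s0 x0 :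
  amzv_partial (s0 :: [seq (r * t)%N | t <- theta])
     (x0 :: [seq x ^+ t | t <- theta]) =
  nested_sum ((fun k => x0 ^+ k / k%:R ^+ s0) ::
     [seq (fun k => (x ^+ k / k%:R ^+ r) ^+ t) | t <- theta]).
Proof.
rewrite amzv_partialE; congr nested_sum.
apply: (@eq_from_nth _ (fun=> 0)) => [|j]; rewrite size_mkseq/= !size_map//.
move=> js; rewrite nth_mkseq/= ?size_map//.
case: j js => //= j js; rewrite !(nth_map 0%N)//.
by apply/funext => k; rewrite exprMn exprVn -!exprM mulnC.
Qed.

(** * Compositions and the multinomial expansion *)

(* [d] is only the recursion depth; the list is complete as soon as [m <= d]. *)
Fixpoint composition_seq (d m : nat) : seq (seq nat) :=
  if m is 0 then [:: [::]] else
  if d is d'.+1 then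
    [seq j :: t | j <- iota 1 m, t <- composition_seq d' (m - j)]
  else [::].

Lemma mem_composition_seq d m theta : (m <= d)%N ->
  (theta \in composition_seq d m) = all (leq 1) theta && (sumn theta == m).
Proof.
elim: d m theta => [|d IHd] [|m] theta // md.
- by rewrite inE; case: theta => [|[|a] t] //=; rewrite addSn andbF.
- by rewrite inE; case: theta => [|[|a] t] //=; rewrite addSn andbF.
- apply/allpairsPdep/idP => [[j [t [jm tm ->]]]|] /=.
    move: jm tm; rewrite (mem_iota 1 m.+1) add1n ltnS => /andP[j0 jm].
    rewrite IHd; last by lia.
    by move=> /andP[-> /eqP->]; rewrite j0 subnKC ?eqxx.
  case: theta => [|j t]//= /andP[/andP[j0 pt] /eqP sm].
  have md' : (m.+1 - j <= d)%N by lia.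
  exists j, t; rewrite (mem_iota 1 m.+1) IHd// pt.
  by split=> //; [lia | apply/eqP; lia].
Qed.

Lemma composition_seq_uniq d m : uniq (composition_seq d m).
Proof.
elim: d m => [|d IHd] [|m] //.
apply: allpairs_uniq_dep => [|j _|]; rewrite ?iota_uniq//.
by move=> [i t] [j u] _ _ /= [-> ->].
Qed.

Lemma compositionsE m : compositions m = [set` composition_seq m m].
Proof.
apply/seteqP; split=> theta /=; rewrite mem_composition_seq//.
  by move=> [-> ->]; rewrite eqxx.
by move=> /andP[? /eqP].
Qed.

Lemma big_composition_seq (V : nmodType) d m (F : seq nat -> V) : (0 < m)%N ->
  \sum_(theta <- composition_seq d.+1 m) F theta =
  \sum_(1 <= j < m.+1) \sum_(theta <- composition_seq d (m - j)) F (j :: theta).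
Proof. by case: m => // m _; rewrite big_allpairs_dep. Qed.

(** The binomial theorem in divided powers x^j / j!, a normalisation in which the multinomial weight
    is a product over the parts and can be built one part at a time. *)
Lemma exp_divfact_addr (R : realType) (x y : R) m :
  (x + y) ^+ m / m`!%:R =
  \sum_(0 <= j < m.+1) (x ^+ j / j`!%:R) * (y ^+ (m - j) / (m - j)`!%:R).
Proof.
rewrite addrC exprDn mulr_suml big_mkord; apply: eq_bigr => -[j] /=.
rewrite ltnS => jm _; rewrite -mulr_natr -(bin_fact jm) !natrM.
have nz k : k`!%:R != 0 :> R by rewrite pnatr_eq0 -lt0n fact_gt0.
have := nz j; have := nz (m - j)%N.
have : ('C(m, j))%:R != 0 :> R by rewrite pnatr_eq0 -lt0n bin_gt0.
by move=> h1 h2 h3; field; rewrite h1 h2 h3.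
Qed.

(* Sort the factors of each monomial of the [m]-th power by decreasing index;
   [theta_i] is the multiplicity of the [i]-th distinct index. *)
Lemma multinomial_nested_sum (R : realType) (x : nat -> R) d m n : (m <= d)%N ->
  (\sum_(0 <= k < n) x k.+1) ^+ m / m`!%:R =
  \sum_(theta <- composition_seq d m)
    (\prod_(t <- theta) t`!%:R)^-1 *
    nested_sum [seq (fun k => x k ^+ t) | t <- theta] n.
Proof.
elim: d m n => [|d IHd] m n.
  rewrite leqn0 => /eqP->.
  by rewrite /= big_seq1 big_nil expr0 fact0 divr1 invr1 mulr1.
case: m => [|m] md; first by rewrite /= big_seq1 big_nil expr0 fact0 divr1 invr1 mulr1.
rewrite big_composition_seq//.
elim: n => [|n IHn].
  rewrite big_geq// expr0n/= mul0r big1// => j _; rewrite big1// => t _ /=.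
  by rewrite big_geq// mulr0.
(* Here j counts the factors equal to the new term [x n.+1]: j = 0 leaves the case [n], and j > 0
   becomes the first part of the composition. *)
rewrite big_nat_recr//= addrC exp_divfact_addr [LHS]big_ltn// expr0 fact0 divr1 mul1r.
rewrite subn0 IHn -big_split/=; apply: eq_big_nat => j /andP[j0 jm].
rewrite IHd; last by lia.
rewrite mulr_sumr -big_split/=; apply: eq_bigr => t _.
rewrite big_cons big_nat_recr//= mulrDr; congr +%R.
by rewrite invfM; ring.
Qed.

(** * Dirichlet's test and bounds for nested harmonic sums *)

(** Abel summation; bounded variation stands in for monotonicity, which signed inner sums may
    violate. *)
Lemma alternating_series_cvg (R : realType) (b : nat -> R) :
  b @ \oo --> 0 -> cvgn (series (fun k => `|b k - b k.+1|)) ->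
  cvgn (series (fun k => (-1) ^+ k * b k)).
Proof.
(* [e k] is the partial sum (-1)^0 + ... + (-1)^k. *)
move=> b0 bv; pose e k : R := (~~ odd k)%:R.
have e1 k : `|e k| <= 1 by rewrite /e; case: odd; rewrite ?normr0 ?normr1.
have abel n : series (fun k => (-1) ^+ k * b k) n.+1 =
    e n * b n + series (fun k => e k * (b k - b k.+1)) n.
  elim: n => [|n IHn].
    by rewrite !seriesEnat/= big_nat1 big_geq// /e/= addr0 expr0.
  rewrite -[LHS]/(series _ n.+2) seriesSr IHn [in RHS]seriesSr.
  have -> : (-1) ^+ n.+1 = e n.+1 - e n.
    by rewrite /e -signr_odd/=; case: odd; rewrite ?expr0 ?expr1 ?subr0 ?sub0r.
  by ring.
apply/cvg_ex; exists (0 + limn (series (fun k => e k * (b k - b k.+1)))).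
rewrite -cvg_shiftS /=.
under eq_fun do rewrite abel.
apply: cvgD.
  apply: norm_cvg0; apply: (squeeze_cvgr _ (cvg_cst 0) ((norm_cvg0P b).2 b0)).
  by apply: nearW => n; rewrite normr_ge0 normrM ler_piMl.
apply: normed_cvg.
apply: (series_le_cvg _ _ _ bv) => k //=.
by rewrite normrM ler_piMl.
Qed.

(** A_p(n), the elementary symmetric polynomial of degree [p] in 1, 1/2, ..., 1/n. *)
Definition nested_harmonic (R : realType) p : nat -> R :=
  nested_sum (nseq p (fun k => k%:R^-1)).

Lemma nested_harmonic_ge0 (R : realType) p n : 0 <= nested_harmonic R p n.
Proof.
rewrite /nested_harmonic; elim: p n => [|p IHp] n; first exact: ler01.
by rewrite /=; apply: sumr_ge0 => k _; rewrite mulr_ge0 ?invr_ge0.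
Qed.

Lemma nested_sum_le (R : realType) (w : seq (nat -> R)) n :
  (forall j k, (j < size w)%N ->
    `|nth (fun=> 0) w j k.+1| <= k.+1%:R^-1) ->
  `|nested_sum w n| <= nested_harmonic R (size w) n.
Proof.
rewrite /nested_harmonic; elim: w n => [|f w IHw] n fw /=; first by rewrite normr1.
apply: le_trans (ler_norm_sum _ _ _) _; apply: ler_sum => k _.
rewrite normrM ler_pM//; first exact: (fw 0%N).
by apply: IHw => j i jw; exact: (fw j.+1).
Qed.

Lemma nested_harmonic_sqr_le (R : realType) p N :
  \sum_(0 <= k < N) nested_harmonic R p k / k.+1%:R ^+ 2 <= 2.
Proof.
elim: p N => [|p IHp] N.
  (* Subtracting 1/N makes the induction on [N] close; at [N] = 0 the inverse is 0 by convention. *)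
  have : \sum_(0 <= k < N) nested_harmonic R 0 k / k.+1%:R ^+ 2 <=
      2 - N%:R^-1 :> R.
    elim: N => [|N IHN]; first by rewrite big_geq// invr0 subr0.
    case: N IHN => [|N] IHN.
      by rewrite big_nat1 /nested_harmonic/= expr1n invr1; lra.
    rewrite big_nat_recr//=.
    apply: le_trans (lerD IHN (lexx _)) _; rewrite div1r.
    have h : 0 < N.+1%:R :> R by [].
    rewrite -[N.+2]addn1 natrD; set y := N.+1%:R in h *.
    rewrite -subr_ge0.
    have -> : 2 - (y + 1%:R)^-1 - (2 - y^-1 + ((y + 1%:R) ^+ 2)^-1) = 
        (y * (y + 1) ^+ 2)^-1.
      by field; rewrite !gt_eqF//; lra.
    by rewrite invr_ge0 mulr_ge0 ?exprn_ge0//; lra.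
  by move=> /le_trans -> //; rewrite gerBl invr_ge0.
(* Summation by parts against [1/(N+1)^2 <= 1/N - 1/(N+1)]. *)
apply: le_trans (IHp N).
(* The nonnegative boundary term A_{p+1}(N)/N is kept for the induction on [N], then dropped. *)
suff : \sum_(0 <= k < N) nested_harmonic R p.+1 k / k.+1%:R ^+ 2 +
    nested_harmonic R p.+1 N / N%:R <=
    \sum_(0 <= k < N) nested_harmonic R p k / k.+1%:R ^+ 2.
  by apply: le_trans; rewrite lerDl divr_ge0 ?nested_harmonic_ge0.
elim: N => [|N IHN]; first by rewrite !big_geq// invr0 mulr0 addr0.
rewrite !big_nat_recr//=.
have -> : nested_harmonic R p.+1 N.+1 =
    nested_harmonic R p.+1 N + N.+1%:R^-1 * nested_harmonic R p N.
  exact: nested_sumS.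
(* The estimate divides by [N], so the step from 0 to 1 is separate: A_{p+1}(0) = 0 and both sides
   equal A_p(0). *)
case: N IHN => [|N] IHN.
  rewrite !big_geq// [nested_harmonic R p.+1 0]big_geq//.
  by rewrite !mul0r expr1n !invr1 !mulr1 mul1r !add0r.
apply: le_trans _ (lerD IHN (lexx _)).
have := nested_harmonic_ge0 R p.+1 N.+1.
have h : 0 < N.+1%:R :> R by [].
rewrite -[N.+2]addn1 natrD; set y := N.+1%:R in h *.
set a := nested_harmonic R p.+1 _ => a0; set c := nested_harmonic R p _.
rewrite -!addrA lerD2l -subr_ge0.
have -> : a / y + c / (y + 1%:R) ^+ 2 -
    (a / (y + 1%:R) ^+ 2 + (a + (y + 1%:R)^-1 * c) / (y + 1%:R)) =
    a / (y * (y + 1) ^+ 2).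
  by field; rewrite !gt_eqF//; lra.
by rewrite divr_ge0// mulr_ge0 ?exprn_ge0//; lra.
Qed.

Lemma nested_harmonic_sqr_cvg (R : realType) p :
  cvgn (series (fun k => nested_harmonic R p k / k.+1%:R ^+ 2)).
Proof.
apply: nondecreasing_is_cvgn.
  apply/nondecreasing_seqP => n; rewrite seriesSr lerDl.
  by rewrite divr_ge0 ?nested_harmonic_ge0 ?exprn_ge0.
by exists 2 => _ [n _ <-]; rewrite seriesEnat; exact: nested_harmonic_sqr_le.
Qed.

(** A_{p+1}(n) sums A_p(k)/(k+1) over k < n; adding the nonnegative term k = n bounds the quotient
    by a Cesaro mean of the previous sequence. *)
Lemma nested_harmonic_div_cvg0 (R : realType) p :
  (fun n => nested_harmonic R p n / n.+1%:R) @ \oo --> (0 : R).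
Proof.
elim: p => [|p IHp].
  rewrite /nested_harmonic/=; under eq_fun do rewrite div1r.
  exact: cvg_harmonic.
apply: (squeeze_cvgr _ (cvg_cst 0) (cesaro IHp)); apply: nearW => n /=.
rewrite divr_ge0 ?nested_harmonic_ge0//= mulrC ler_wpM2l ?invr_ge0//.
rewrite seriesSr seriesEnat/= {1}/nested_harmonic/=.
under eq_bigr do rewrite mulrC.
by rewrite lerDl divr_ge0 ?nested_harmonic_ge0.
Qed.

(** * Convergence of the multiple zeta values *)

Lemma nested_sum_cvg_abs (R : realType) (f : nat -> R) w :
  (forall k, `|f k.+1| <= k.+1%:R ^- 2) ->
  (forall j k, (j < size w)%N ->
    `|nth (fun=> 0) w j k.+1| <= k.+1%:R^-1) ->
  cvgn (nested_sum (f :: w)).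
Proof.
move=> f2 fw; change (cvgn (series (fun k => f k.+1 * nested_sum w k))).
apply: normed_cvg.
apply: (series_le_cvg _ _ _ (@nested_harmonic_sqr_cvg R (size w))) => k //=.
  by rewrite divr_ge0 ?nested_harmonic_ge0 ?exprn_ge0.
by rewrite normrM mulrC ler_pM ?nested_sum_le.
Qed.

Lemma nested_sum_cvg_alt (R : realType) w :
  (forall j k, (j < size w)%N ->
    `|nth (fun=> 0) w j k.+1| <= k.+1%:R^-1) ->
  cvgn (nested_sum ((fun k => (-1) ^+ k / k%:R) :: w) : nat -> R).
Proof.
move=> fw; pose b k := nested_sum w k / k.+1%:R.
have -> : nested_sum ((fun k => (-1) ^+ k / k%:R) :: w) =
    \- series (fun k => (-1) ^+ k * b k).
  apply/funext => n; rewrite seriesEnat/= -sumrN; apply: eq_bigr => k _.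
  by rewrite /b exprS; ring.
apply: is_cvgN; apply: alternating_series_cvg.
  apply: norm_cvg0.
  apply: (squeeze_cvgr _ (cvg_cst 0) (@nested_harmonic_div_cvg0 R (size w))).
  apply: nearW => n; rewrite normr_ge0 /b normrM [`|_^-1|]ger0_norm ?invr_ge0//=.
  by rewrite ler_wpM2r ?invr_ge0 ?nested_sum_le.
(* The variation of [b] has two sources: the denominator, controlled by A_p, and the increment of
   the inner sum, which frees one weight and is controlled by A_{p-1}. *)
have ABcvg : cvgn (series (fun k =>
    nested_harmonic R (size w) k / k.+1%:R ^+ 2 +
    nested_harmonic R (size w).-1 k / k.+1%:R ^+ 2)).
  by apply: is_cvg_seriesD; exact: nested_harmonic_sqr_cvg.
apply: (series_le_cvg _ _ _ ABcvg) => k //=.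
  by rewrite addr_ge0// divr_ge0 ?nested_harmonic_ge0 ?exprn_ge0.
have k0 : 0 < k.+1%:R :> R by [].
have -> : b k - b k.+1 = nested_sum w k / (k.+1%:R * k.+2%:R) -
    (nested_sum w k.+1 - nested_sum w k) / k.+2%:R.
  rewrite /b -[k.+2]addn1 natrD; field.
  by rewrite !gt_eqF// addr_gt0.
have k2 : k.+2%:R^-1 <= k.+1%:R^-1 :> R by rewrite lef_pV2 ?posrE// ler_nat.
apply: le_trans (ler_normB _ _) _; apply: lerD; rewrite normrM.
  apply: ler_pM => //; first exact: nested_sum_le.
  by rewrite ger0_norm ?invr_ge0 ?mulr_ge0// expr2 !invfM ler_wpM2l.
(* Without inner weights the inner sum is constantly 1 and its increment vanishes. *)
case: w fw {b ABcvg} => [|f w] fw.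
  by rewrite subrr normr0 mul0r divr_ge0 ?nested_harmonic_ge0 ?exprn_ge0.
rewrite nested_sumS addrAC subrr add0r normrM.
rewrite [_ * `|nested_sum _ _|]mulrC -mulrA; apply: ler_pM => //.
  by apply: nested_sum_le => j i jw; exact: (fw j.+1).
rewrite expr2 invfM; apply: ler_pM => //; first exact: (fw 0%N).
by rewrite ger0_norm ?invr_ge0.
Qed.

Lemma exprn_weight_le (R : realType) (x : R) (r t k : nat) :
  `|x| = 1 -> (0 < r)%N -> (0 < t)%N ->
  `|(x ^+ k.+1 / k.+1%:R ^+ r) ^+ t| <= k.+1%:R^-1.
Proof.
move=> x1 r0 t0; rewrite normrX normrM normrX x1 expr1n mul1r.
rewrite ger0_norm ?invr_ge0 ?exprn_ge0// exprVn -exprM lef_pV2 ?posrE ?exprn_gt0//.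
by rewrite ler_eXnr ?muln_gt0 ?r0// ler1n.
Qed.

Lemma power_weights_le (R : realType) (x : R) (r : nat) (theta : seq nat) :
  `|x| = 1 -> (0 < r)%N -> all (leq 1) theta ->
  forall j k, (j < size [seq (fun k => (x ^+ k / k%:R ^+ r) ^+ t)
                        | t <- theta])%N ->
    `|nth (fun=> 0) [seq (fun k => (x ^+ k / k%:R ^+ r) ^+ t) | t <- theta]
        j k.+1| <= k.+1%:R^-1.
Proof.
move=> x1 r0 /all_nthP pos j k; rewrite size_map => jt.
by rewrite (nth_map 0%N)// exprn_weight_le// pos.
Qed.

(** For signs, the final disjunction is the admissibility condition that the leading pair differ
    from (1, 1). Leading exponent at least 2 gives absolute convergence; exponent 1 forces the sign
    -1 and Dirichlet's test. *)
Lemma amzv_partial_cvg (R : realType) (r s0 : nat) (x x0 : R) (theta : seq nat) :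
  `|x| = 1 -> `|x0| = 1 -> (0 < r)%N -> (0 < s0)%N -> all (leq 1) theta ->
  (1 < s0)%N \/ x0 = -1 ->
  cvgn (amzv_partial (s0 :: [seq (r * t)%N | t <- theta])
     (x0 :: [seq x ^+ t | t <- theta])).
Proof.
move=> x1 x01 r0 s00 pos adm; rewrite amzv_partial_map.
have [s02|s02] := ltnP 1 s0.
  apply: nested_sum_cvg_abs; last exact: power_weights_le.
  move=> k; rewrite normrM normrX x01 expr1n mul1r.
  rewrite ger0_norm ?invr_ge0 ?exprn_ge0// lef_pV2 ?posrE ?exprn_gt0//.
  by rewrite ler_weXn2l ?ler1n.
case: adm => [|->]; first by rewrite ltnNge s02.
have -> : s0 = 1%N by apply/eqP; rewrite eqn_leq s02.
exact: nested_sum_cvg_alt (power_weights_le x1 r0 pos).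
Qed.

(** * Euler sums as combinations of multiple zeta values *)

Lemma euler_sum_partialE (R : realType) (x x0 : R) (r m q N : nat) : (0 < m)%N ->
  \sum_(1 <= n < N.+1)
    x0 ^+ n / n%:R ^+ q * (\sum_(1 <= k < n.+1) x ^+ k / k%:R ^+ r) ^+ m =
  \sum_(theta <- composition_seq m m) multinom_coef R m theta *
    (amzv_partial (exps_cons q r theta) (x0 :: [seq x ^+ t | t <- theta]) N +
     amzv_partial (exps_merge q r theta)
       (x0 * x ^+ head 0%N theta :: [seq x ^+ t | t <- behead theta]) N).
Proof.
move=> m0; pose y (k : nat) : R := x ^+ k / k%:R ^+ r.
transitivity (\sum_(theta <- composition_seq m m) multinom_coef R m theta *
    \sum_(0 <= n < N) x0 ^+ n.+1 / n.+1%:R ^+ q *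
      nested_sum [seq (fun k => y k ^+ t) | t <- theta] n.+1).
  rewrite big_add1/=.
  under eq_bigr => n _.
    rewrite big_add1/=.
    have fm0 : m`!%:R != 0 :> R by rewrite pnatr_eq0 -lt0n fact_gt0.
    rewrite -[X in _ * X](mulfVK fm0) (multinomial_nested_sum y _ (leqnn m)).
    rewrite mulr_suml mulr_sumr; over.
  rewrite exchange_big/=; apply: eq_bigr => theta _.
  rewrite mulr_sumr; apply: eq_bigr => n _; rewrite /multinom_coef; ring.
(* Membership rules out the empty composition, which has no first part to merge. *)
rewrite !big_seq; apply: eq_bigr => -[|j theta].
  by rewrite mem_composition_seq// => /andP[_ /eqP/= m0']; rewrite -m0' in m0.
move=> _; congr *%R.
rewrite /exps_cons /exps_merge !amzv_partial_map -[map _ (j :: _)]/(_ :: _).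
(* The inner range n_1 <= n is split: n_1 < n gives the longer string, and n_1 = n merges the outer
   weight with that of the first part. *)
rewrite [LHS](eq_bigr (fun n => x0 ^+ n.+1 / n.+1%:R ^+ q *
   nested_sum [seq (fun k => y k ^+ t) | t <- j :: theta] n +
   ((x0 * x ^+ j) ^+ n.+1 / n.+1%:R ^+ (q + r * j)) *
     nested_sum [seq (fun k => y k ^+ t) | t <- theta] n)); last first.
  move=> n _; rewrite nested_sumS mulrDr; congr +%R; rewrite mulrA; congr *%R.
  rewrite /y exprMn exprVn -!exprM exprMn -exprM [(j * _)%N]mulnC.
  by rewrite exprD invfM; ring.
by rewrite big_split.
Qed.

Lemma cvgn_bigsum (R : realType) (I : eqType) (s : seq I) (c : I -> R)
    (u v : I -> nat -> R) :
  (forall i, i \in s -> cvgn (u i) /\ cvgn (v i)) ->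
  (fun n => \sum_(i <- s) c i * (u i n + v i n)) @ \oo -->
  \sum_(i <- s) c i * (limn (u i) + limn (v i)).
Proof.
elim: s => [_|i s IHs uv].
  by rewrite big_nil; under eq_fun do rewrite big_nil; exact: cvg_cst.
rewrite big_cons; under eq_fun do rewrite big_cons.
have [cu cv] := uv i (mem_head _ _).
apply: cvgD; last by apply: IHs => j js; apply: uv; rewrite inE js orbT.
by apply: cvgM; [exact: cvg_cst | exact: cvgD].
Qed.

(** Common source of the three formulas: [x] carries the inner sign, [x0] the outer one, and [c] the
    global sign. *)
Lemma euler_sum_cvg (R : realType) (c x x0 : R) (r m q : nat) :
  `|x| = 1 -> `|x0| = 1 -> (0 < r)%N -> (0 < m)%N -> (0 < q)%N ->
  (1 < q)%N \/ x0 = -1 ->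
  (forall theta, compositions m theta ->
     cvgn (amzv_partial (exps_cons q r theta) (x0 :: [seq x ^+ t | t <- theta]))
     /\
     cvgn (amzv_partial (exps_merge q r theta)
       (x0 * x ^+ head 0%N theta :: [seq x ^+ t | t <- behead theta]))) /\
  (fun N => c * \sum_(1 <= n < N.+1)
    x0 ^+ n / n%:R ^+ q * (\sum_(1 <= k < n.+1) x ^+ k / k%:R ^+ r) ^+ m)
  @ \oo --> c * \sum_(theta \in compositions m) multinom_coef R m theta *
    (amzv (exps_cons q r theta) (x0 :: [seq x ^+ t | t <- theta]) +
     amzv (exps_merge q r theta)
       (x0 * x ^+ head 0%N theta :: [seq x ^+ t | t <- behead theta])).
Proof.
move=> x1 x01 r0 m0 q0 adm.
have cvg_theta theta : compositions m theta ->
     cvgn (amzv_partial (exps_cons q r theta) (x0 :: [seq x ^+ t | t <- theta]))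
     /\
     cvgn (amzv_partial (exps_merge q r theta)
       (x0 * x ^+ head 0%N theta :: [seq x ^+ t | t <- behead theta])).
  case: theta => [[_ /= m0']|j theta [/= /andP[j0 pos] _]].
    by rewrite -m0' in m0.
  split; first by apply: (@amzv_partial_cvg _ r q x x0 (j :: theta)); rewrite //= j0.
  (* The merged leading exponent is at least 2, so its sign is irrelevant. *)
  apply: amzv_partial_cvg => //.
  - by rewrite normrM normrX x1 x01 expr1n mulr1.
  - by rewrite addn_gt0 q0.
  - by left; rewrite -addn1 leq_add// muln_gt0 r0.
split => //.
under eq_fun do rewrite euler_sum_partialE//.
rewrite compositionsE -fsbig_seq ?composition_seq_uniq//.
apply: cvgM; first exact: cvg_cst.
by apply: cvgn_bigsum => theta th; apply: cvg_theta; rewrite compositionsE.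
Qed.

Theorem theorem5p3 (R : realType) (m r : nat) (hm : (1 <= m)%N)
    (hr : (1 <= r)%N) :
  [/\ forall q : nat, (1 <= q)%N ->
      [/\ cvgn (S_pow_bar_partial R r m q),
          forall theta, compositions m theta ->
            cvgn (amzv_partial (exps_cons q r theta) (-1 :: ones R theta)) /\
            cvgn (amzv_partial (exps_merge q r theta)
                    (-1 :: ones R (behead theta)))
        & S_pow_bar R r m q =
          - \sum_(theta \in compositions m) multinom_coef R m theta *
              (amzv (exps_cons q r theta) (-1 :: ones R theta) +
               amzv (exps_merge q r theta) (-1 :: ones R (behead theta)))],
      forall q : nat, (2 <= q)%N ->
      [/\ cvgn (S_barpow_partial R r m q),
          forall theta, compositions m theta ->
            cvgn (amzv_partial (exps_cons q r theta)
                    (1 :: parities R theta)) /\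
            cvgn (amzv_partial (exps_merge q r theta)
                    ((-1) ^+ head 0%N theta :: parities R (behead theta)))
        & S_barpow R r m q =
          (-1) ^+ m *
          \sum_(theta \in compositions m) multinom_coef R m theta *
            (amzv (exps_cons q r theta) (1 :: parities R theta) +
             amzv (exps_merge q r theta)
               ((-1) ^+ head 0%N theta :: parities R (behead theta)))]
    & forall q : nat, (1 <= q)%N ->
      [/\ cvgn (S_barpow_bar_partial R r m q),
          forall theta, compositions m theta ->
            cvgn (amzv_partial (exps_cons q r theta)
                    (-1 :: parities R theta)) /\
            cvgn (amzv_partial (exps_merge q r theta)
                    ((-1) ^+ (head 0%N theta).+1 ::
                       parities R (behead theta)))
        & S_barpow_bar R r m q =
          (-1) ^+ m.+1 *
          \sum_(theta \in compositions m) multinom_coef R m theta *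
            (amzv (exps_cons q r theta) (-1 :: parities R theta) +
             amzv (exps_merge q r theta)
               ((-1) ^+ (head 0%N theta).+1 ::
                  parities R (behead theta)))]].
Proof.
(* Passing from exponent n-1 to n costs a factor -1 for the outer sign and (-1)^m for the inner
   power; their products are the global signs of the three cases. *)
have signE n : (0 < n)%N -> (-1) ^+ n.-1 = - (-1) ^+ n :> R.
  by case: n => // n _; rewrite exprS mulN1r opprK.
have altXE n : alt_harmonic_num R r n ^+ m =
    (-1) ^+ m * (\sum_(1 <= k < n.+1) (-1) ^+ k / k%:R ^+ r) ^+ m.
  rewrite -exprNn; congr (_ ^+ _); rewrite -sumrN; apply: eq_big_nat => k /andP[k0 _].
  by rewrite signE// mulNr.
have N1 : `|-1| = 1 :> R by rewrite normrN1.
have onesE (theta : seq nat) : ones R theta = [seq 1 ^+ t | t <- theta].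
  by apply: eq_map => t; rewrite expr1n.
split=> q q0.
- have [cvg_theta cvg_S] := @euler_sum_cvg R (-1) 1 (-1) r m q (normr1 _) N1
    hr hm q0 (or_intror erefl).
  have SE : S_pow_bar_partial R r m q = fun N => -1 * \sum_(1 <= n < N.+1)
      (-1) ^+ n / n%:R ^+ q * (\sum_(1 <= k < n.+1) 1 ^+ k / k%:R ^+ r) ^+ m.
    apply/funext => N; rewrite mulN1r -sumrN; apply: eq_big_nat => n /andP[n0 _].
    rewrite signE// -mulrA mulNr; congr (- (_ * _)); rewrite mulrC; congr *%R.
    by congr GRing.exp; apply: eq_bigr => k _; rewrite expr1n.
  split.
  + by rewrite SE; apply/cvg_ex; eexists; exact: cvg_S.
  + move=> theta /cvg_theta; rewrite !onesE.
    by rewrite expr1n mulr1.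
  + rewrite /S_pow_bar SE (cvg_lim _ cvg_S)// mulN1r; congr (- _).
    apply: eq_fsbigr => theta _.
    by rewrite !onesE expr1n mulr1.
- have [cvg_theta cvg_S] := @euler_sum_cvg R ((-1) ^+ m) (-1) 1 r m q N1 (normr1 _)
    hr hm (ltnW q0) (or_introl q0).
  have SE : S_barpow_partial R r m q = fun N => (-1) ^+ m * \sum_(1 <= n < N.+1)
      1 ^+ n / n%:R ^+ q * (\sum_(1 <= k < n.+1) (-1) ^+ k / k%:R ^+ r) ^+ m.
    apply/funext => N; rewrite mulr_sumr; apply: eq_bigr => n _.
    by rewrite altXE expr1n mul1r [_^-1 * _]mulrC mulrA.
  split.
  + by rewrite SE; apply/cvg_ex; eexists; exact: cvg_S.
  + by move=> theta /cvg_theta; rewrite mul1r.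
  + rewrite /S_barpow SE (cvg_lim _ cvg_S)//; congr *%R.
    by apply: eq_fsbigr => theta _; rewrite mul1r.
- have [cvg_theta cvg_S] := @euler_sum_cvg R ((-1) ^+ m.+1) (-1) (-1) r m q N1 N1
    hr hm q0 (or_intror erefl).
  have SE : S_barpow_bar_partial R r m q =
      fun N => (-1) ^+ m.+1 * \sum_(1 <= n < N.+1)
      (-1) ^+ n / n%:R ^+ q * (\sum_(1 <= k < n.+1) (-1) ^+ k / k%:R ^+ r) ^+ m.
    apply/funext => N; rewrite mulr_sumr; apply: eq_big_nat => n /andP[n0 _].
    rewrite signE// altXE exprS.
    by move: (_ ^+ m) ((-1) ^+ n) ((-1) ^+ m) => h a c; ring.
  split.
  + by rewrite SE; apply/cvg_ex; eexists; exact: cvg_S.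
  + by move=> theta /cvg_theta; rewrite -exprS.
  + rewrite /S_barpow_bar SE (cvg_lim _ cvg_S)//; congr *%R.
    by apply: eq_fsbigr => theta _; rewrite -exprS.
Qed.
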